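(* Let $H$ be an infinite dimensional separable complex Hilbert space and let $T\in\mathcal{B}(H)$ be a complex symmetric operator. Then: (1) $m(T)=m(T^* )$; (2) $T$ is bounded below if and only if $T$ is invertible; (3) $m(T)>0$ if and only if $T$ is invertible.
   Context: $\mathcal{B}(H)$ is the algebra of bounded linear operators on $H$. A conjugation on $H$ is an antilinear isometry $C:H\to H$ with $C^2=I$. An operator $T\in\mathcal{B}(H)$ is complex symmetric if there is a conjugation $C$ on $H$ with $T=CT^*C$. The minimum modulus is $m(T)=\inf\{\|Tx\|:x\in H,\ \|x\|=1\}$. $T$ is bounded below if there is $c>0$ with $\|Tx\|\ge c\|x\|$ for all $x\in H$. Invertible means invertible in $\mathcal{B}(H)$. *)

(* Defs.v *)
From HB Require Import structures.
From mathcomp Require Import all_boot all_order all_algebra.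
From mathcomp Require Import sesquilinear.
From mathcomp Require Import complex.
From mathcomp Require Import boolp classical_sets cardinality reals.
From mathcomp Require Import topology normedtype.

Set Implicit Arguments.
Unset Strict Implicit.
Unset Printing Implicit Defensive.

Import Order.TTheory GRing.Theory Num.Theory.
Import numFieldNormedType.Exports.

Local Open Scope classical_set_scope.
Local Open Scope ring_scope.

(* The inner product is linear in its first argument and conjugate-linear in
   its second one.  Norms of vectors are elements of R[i] (they are real and
   nonnegative there), as for every normed module over R[i]. *)
HB.mixin Record CompleteNormedModule_isHilbert (R : realType) (H : Type)
    of CompleteNormedModule R[i] H := {
  hdot : H -> H -> R[i] ;
  hdot_linearl : forall (a : R[i]) (x y z : H),
    hdot (a *: x + y) z = a * hdot x z + hdot y z ;
  hdot_conj : forall x y : H, hdot x y = (hdot y x)^* ;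
  hdot_norm : forall x : H, hdot x x = `|x| ^+ 2 }.

#[short(type="hilbertType")]
HB.structure Definition Hilbert (R : realType) :=
  {H of CompleteNormedModule R[i] H & CompleteNormedModule_isHilbert R H}.

Notation "''[' x , y ]" := (hdot x y) : ring_scope.

Section HilbertDot.
Variables (R : realType) (H : hilbertType R).

Let hdot_linear_l (z : H) : linear_for *%R (fun x : H => '[x, z]).
Proof. by move=> a x y; exact: hdot_linearl. Qed.

Let hdot_linear_r (z : H) : linear_for (Num.conj \; *%R) (hdot z).
Proof.
move=> a x y; rewrite hdot_conj hdot_linearl rmorphD rmorphM /=.
by rewrite -!hdot_conj.
Qed.

HB.instance Definition _ :=
  bilinear_isBilinear.Build R[i] H H R[i] *%R (Num.conj \; *%R)
    (@hdot R H) (hdot_linear_l, hdot_linear_r).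

Let hdot_herm (x y : H) : '[x, y] = (-1) ^+ false * ('[y, x])^*.
Proof. by rewrite expr0 mul1r; exact: hdot_conj. Qed.

HB.instance Definition _ :=
  isHermitianSesquilinear.Build R[i] H false Num.conj (@hdot R H) hdot_herm.

Let hdot_gt0 (x : H) : x != 0 -> 0 < '[x, x].
Proof. by move=> x0; rewrite hdot_norm exprn_gt0 // normr_gt0. Qed.

HB.instance Definition _ := isDotProduct.Build R[i] H (@hdot R H) hdot_gt0.

End HilbertDot.

Section Operators.
Variables (R : realType) (H : hilbertType R).
Implicit Types (S T C : H -> H).

Definition infinite_dimensional : Prop :=
  ~ exists (n : nat) (e : 'I_n -> H),
      forall x : H, exists c : 'I_n -> R[i], x = \sum_(i < n) c i *: e i.

Definition separable : Prop := exists2 D : set H, countable D & dense D.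

Definition bounded_operator T : Prop :=
  linear T /\ exists M : R, forall x : H, `|T x| <= (M%:C)%C * `|x|.

(* For bounded T, the Riesz representation theorem gives exactly one z such
   that <T x, y> = <x, z> for all x. *)
Definition adjoint T (y : H) : H :=
  xget 0 [set z | forall x : H, '[T x, y] = '[x, z]].

Definition conjugation C : Prop :=
  [/\ linear_for (Num.conj \; *:%R) C,
      forall x, `|C x| = `|x| &
      forall x, C (C x) = x].

Definition complex_symmetric T : Prop :=
  exists2 C, conjugation C & T = C \o adjoint T \o C.

(* Norms are taken in R[i]; complex.Re reads them as elements of R, where the
   infimum lives. *)
Definition min_modulus T : R :=
  inf [set complex.Re `|T x| | x in [set x : H | `|x| = 1]].

Definition bounded_below T : Prop :=
  exists2 c : R, 0 < c & forall x : H, (c%:C)%C * `|x| <= `|T x|.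

Definition invertible T : Prop :=
  exists S, [/\ bounded_operator S, S \o T = id & T \o S = id].

End Operators.

Arguments infinite_dimensional {R} H.
Arguments separable {R} H.

(* Main.v *)
(* If T = C T^* C then T^* = C T C, and C is an isometric bijection, so T and
   T^* take the same norms on the unit sphere.  If T is bounded below, then so
   is T^*, hence ker T^* = (ran T)^perp is trivial.  Since T is bounded below,
   a minimizing sequence for |y - T x| is Cauchy in x as well, so that y has a
   nearest point in ran T; the difference is orthogonal to ran T, hence zero,
   and T is onto. *)

Require Import Defs.
From mathcomp Require Import all_boot all_order all_algebra reals.
From mathcomp Require Import complex boolp classical_sets.
From mathcomp Require Import topology normedtype interval_inference.
From mathcomp Require Import ring lra.

Import Order.TTheory GRing.Theory Num.Theory numFieldNormedType.Exports.

Local Open Scope classical_set_scope.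
Local Open Scope ring_scope.

(** * Real-valued norms *)

Section RealNorm.
Set Implicit Arguments.
Unset Strict Implicit.
Variables (R : realType) (V : normedModType R[i]).
Implicit Types x y : V.

(** Norms live in [R[i]]; passing to [R] gives access to infima and to the total order used by
    [lra]. *)
Definition nrm x : R := complex.Re `|x|.

Lemma nrmE x : `|x| = ((nrm x)%:C)%C.
Proof. by rewrite /nrm RRe_real ?normr_real. Qed.

Lemma nrm_ge0 x : 0 <= nrm x.
Proof. by rewrite -ler0c -nrmE normr_ge0. Qed.

Lemma nrm_eq0 x : nrm x = 0 -> x = 0.
Proof. by move=> x0; apply/normr0_eq0; rewrite nrmE x0. Qed.

Lemma nrm0 : nrm 0 = 0.
Proof. by rewrite /nrm normr0. Qed.

Lemma nrmN x : nrm (- x) = nrm x.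
Proof. by rewrite /nrm normrN. Qed.

Lemma nrm_triangle x y : nrm (x + y) <= nrm x + nrm y.
Proof. by rewrite -lecR rmorphD/= -!nrmE ler_normD. Qed.

Lemma nrmZ (a : R) x : nrm ((a%:C)%C *: x) = `|a| * nrm x.
Proof.
by rewrite /nrm normrZ normc_def/= expr0n addr0 sqrtr_sqr nrmE -rmorphM.
Qed.

End RealNorm.

(** * Inner product identities and orthogonality *)

Section HilbertLemmas.
Set Implicit Arguments.
Unset Strict Implicit.
Variables (R : realType) (H : hilbertType R).
Implicit Types (x y u w : H) (T C : H -> H).

Lemma hdotDl x y z : '[x + y, z] = '[x, z] + '[y, z].
Proof. by have := hdot_linearl 1 x y z; rewrite scale1r mul1r. Qed.

Lemma hdot0l z : '[(0 : H), z] = 0.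
Proof. by apply: (addrI '[(0 : H), z]); rewrite -hdotDl !addr0. Qed.

Lemma hdotZl a x z : '[a *: x, z] = a * '[x, z].
Proof. by have := hdot_linearl a x 0 z; rewrite hdot0l !addr0. Qed.

Lemma hdotNl x z : '[- x, z] = - '[x, z].
Proof. by rewrite -scaleN1r hdotZl mulN1r. Qed.

Lemma hdotDr x y z : '[z, x + y] = '[z, x] + '[z, y].
Proof. by rewrite hdot_conj hdotDl rmorphD/= -!hdot_conj. Qed.

Lemma hdotZr a x z : '[z, a *: x] = a^* * '[z, x].
Proof. by rewrite hdot_conj hdotZl rmorphM/= -hdot_conj. Qed.

Lemma hdotNr x z : '[z, - x] = - '[z, x].
Proof. by rewrite hdot_conj hdotNl rmorphN/= -hdot_conj. Qed.

Lemma hdot_eq0 x : '[x, x] = 0 -> x = 0.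
Proof. by rewrite hdot_norm => /eqP; rewrite expf_eq0/= => /eqP/normr0_eq0. Qed.

Lemma parallelogram x y :
  nrm (x + y) ^+ 2 + nrm (x - y) ^+ 2 = 2 * (nrm x ^+ 2 + nrm y ^+ 2).
Proof.
apply: (@complexI R).
rewrite rmorphM rmorph_nat !rmorphD !rmorphXn/= -!nrmE -!hdot_norm.
rewrite !hdotDl !hdotDr !hdotNl !hdotNr; ring.
Qed.

(** Subtracting from [w] its projection on [u] lowers the squared norm by [|p|^2 / q], where p = <w,
    u> and q = <u, u>; minimality of [w] forces p = 0. *)
Lemma orthogonal_of_nearest w u :
  (forall a : R[i], nrm w <= nrm (w - a *: u)) -> '[w, u] = 0.
Proof.
move=> wmin; have [->|u0] := eqVneq u 0.
  by rewrite hdot_conj hdot0l rmorph0.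
have q0 : 0 < '[u, u] by rewrite hdot_norm exprn_gt0// normr_gt0.
pose a := '[w, u] / '[u, u].
have := wmin a.
rewrite -(@ler_pXn2r _ 2)// ?nnegrE ?nrm_ge0// -lecR !rmorphXn/= -!nrmE.
have aE : a^* = ('[w, u])^* / '[u, u].
  by rewrite rmorphM fmorphV/= -(hdot_conj u u).
rewrite -!hdot_norm !hdotDl !hdotDr !hdotNl !hdotNr !hdotZl !hdotZr.
rewrite aE (hdot_conj u w) /a.
set p := '[w, u]; set q := '[u, u] in q0 *.
have -> : '[w, w] - p^* / q * p + (- (p / q * p^*) - - (p / q * (p^* / q * q)))
    = '[w, w] - `|p| ^+ 2 / q.
  by rewrite normCK; field; rewrite gt_eqF.
rewrite lerDl oppr_ge0 => le0.
have : `|p| ^+ 2 / q == 0 by rewrite eq_le le0 divr_ge0 ?exprn_ge0// ltW.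
rewrite mulf_eq0 invr_eq0 (gt_eqF q0) orbF expf_eq0/= => /eqP.
exact: normr0_eq0.
Qed.

(** * Operator bounds in real norms *)

Lemma bounded_operator_nrm T :
  bounded_operator T -> exists2 M : R, 0 < M & forall x, nrm (T x) <= M * nrm x.
Proof.
(* The given [M] may be zero or negative; later arguments divide by the bound. *)
move=> [_ [M TM]]; exists (`|M| + 1) => [|x]; first by rewrite ltr_wpDl.
have := TM x; rewrite !nrmE -rmorphM lecR => /le_trans; apply.
by rewrite ler_wpM2r ?nrm_ge0// (le_trans (ler_norm M))// lerDl.
Qed.

Lemma bounded_below_nrm T : bounded_below T <->
  exists2 c : R, 0 < c & forall x, c * nrm x <= nrm (T x).
Proof.
by split=> -[c c0 cT]; exists c => // x; have := cT x;
  rewrite !nrmE -rmorphM lecR.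
Qed.

(** * Nearest points in the range *)

Lemma cvg_of_square_bound (x_ : nat -> H) (K : R) : 0 < K ->
  (forall n m, nrm (x_ n - x_ m) ^+ 2 <= K * (n.+1%:R^-1 + m.+1%:R^-1)) ->
  exists x, forall e : R, 0 < e -> \forall n \near \oo, nrm (x - x_ n) < e.
Proof.
move=> K0 xK.
have /cauchy_cvgP/cvg_ex[x xx] : cauchy (x_ @ \oo).
  apply: cauchy_exP => eps eps0.
  (* A positive element of [R[i]] is real, so a real [e] can replace [eps]. *)
  have epsE : eps = ((complex.Re eps)%:C)%C by rewrite RRe_real// gtr0_real.
  move: eps0; rewrite epsE (ltcR 0); move: (complex.Re _) => e e0.
  (* Two reciprocals below this threshold, multiplied by [K], sum to less than [e ^+ 2]. *)
  have d0 : 0 < e ^+ 2 / (2 * K) by rewrite divr_gt0 ?exprn_gt0 ?mulr_gt0.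
  have [N _ HN] := near_infty_natSinv_lt (PosNum d0).
  exists (x_ N); exists N => // n /= Nn.
  rewrite -ball_normE/= nrmE ltcR -(@ltr_pXn2r _ 2)// ?nnegrE ?nrm_ge0 ?ltW//.
  apply: (le_lt_trans (xK N n)); rewrite -ltr_pdivlMl//.
  have /= h1 := HN N (leqnn N); have /= h2 := HN n Nn.
  have -> : K^-1 * e ^+ 2 = e ^+ 2 / (2 * K) + e ^+ 2 / (2 * K).
    by field; rewrite gt_eqF.
  exact: ltrD.
exists x => e e0.
have /cvgrPdist_lt/(_ (e%:C)%C) := xx; rewrite (ltcR 0) => /(_ e0).
by apply: filterS => n; rewrite nrmE ltcR.
Qed.

Lemma exists_nearest_image T y : bounded_operator T -> bounded_below T ->
  exists x, forall u, nrm (y - T x) <= nrm (y - T u).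
Proof.
move=> bT /bounded_below_nrm[c c0 cT].
have [M M0 TM] := bounded_operator_nrm bT.
have TB : {morph T : x y / x - y} := zmod_morphism_linear bT.1.
have TD u v : T (u + v) = T u + T v by have := bT.1 1 u v; rewrite !scale1r.
have TZ : scalable T := scalable_linear bT.1.
(* Distances are squared to match the parallelogram law. *)
pose A := [set nrm (y - T u) ^+ 2 | u in [set: H]].
have lbA : has_lbound A by exists 0 => _ [u _ <-]; exact: exprn_ge0 (nrm_ge0 _).
have D_le u : inf A <= nrm (y - T u) ^+ 2 by apply: ge_inf => //; exists u.
have /choice[x_ x_D] : forall n, exists x,
    nrm (y - T x) ^+ 2 < inf A + n.+1%:R^-1.
  move=> n; have infA : has_inf A by split=> //; exists (nrm (y - T 0) ^+ 2), 0.
  have [//|_ [x _ <-] xlt] := inf_adherent (_ : 0 < n.+1%:R^-1) infA.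
  by exists x.
(* The parallelogram law bounds |T (x_m - x_n)|^2 by twice the sum of the two errors; the lower
   bound [c] then costs a factor 1/c^2. *)
have [|n m|x xx] := @cvg_of_square_bound x_ (2 / c ^+ 2).
- by rewrite divr_gt0 ?exprn_gt0.
- have := parallelogram (y - T (x_ n)) (y - T (x_ m)).
  have -> : y - T (x_ n) - (y - T (x_ m)) = T (x_ m - x_ n).
    by rewrite TB opprB addrC addrA subrK.
  (* The midpoint gives the lower bound 4 inf A for the other diagonal. *)
  have -> : y - T (x_ n) + (y - T (x_ m)) =
      (2%:C)%C *: (y - T ((2^-1%:C)%C *: (x_ n + x_ m))).
    rewrite scalerBr TZ scalerA -rmorphM mulfV// scale1r TD opprD addrACA.
    by rewrite rmorph_nat scaler_nat mulr2n.
  rewrite nrmZ ger0_norm// exprMn => para.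
  have cxx := cT (x_ m - x_ n).
  have := D_le ((2^-1%:C)%C *: (x_ n + x_ m)).
  move: (nrm (y - _)) para => a para Da.
  have -> : nrm (x_ n - x_ m) = nrm (x_ m - x_ n) by rewrite -nrmN opprB.
  rewrite mulrAC ler_pdivlMr ?exprn_gt0//.
  have := x_D n; have := x_D m.
  have : (c * nrm (x_ m - x_ n)) ^+ 2 <= nrm (T (x_ m - x_ n)) ^+ 2.
    by rewrite ler_pXn2r// nnegrE ?nrm_ge0// mulr_ge0 ?nrm_ge0// ltW.
  rewrite exprMn; move: (n.+1%:R^-1) (m.+1%:R^-1) => p q; lra.
exists x => u; rewrite leNgt; apply/negP => us.
set r := nrm (y - T x) in us *; set s := nrm (y - T u) in us *.
have s0 : 0 <= s := nrm_ge0 _.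
(* If s < r, the level (r + s)/2 separates them: for large n, |y - T x_n| lies above it because x_n
   is close to x, and below it because its square is less than inf A + 1/(n+1). *)
have d0 : 0 < ((r + s) / 2) ^+ 2 - s ^+ 2 by nra.
have e0 : 0 < (r - s) / 2 / M by rewrite !divr_gt0// subr_gt0.
have [n [/= xn dn]] :=
  filter_ex (filterI (xx _ e0) (near_infty_natSinv_lt (PosNum d0))).
have : r <= nrm (y - T (x_ n)) + M * nrm (x - x_ n).
  rewrite -[r]nrmN opprB; have -> : T x - y = - (y - T (x_ n)) + T (x - x_ n).
    by rewrite TB opprB [RHS]addrC addrA subrK.
  by rewrite (le_trans (nrm_triangle _ _))// nrmN lerD2l.
move: xn; rewrite ltr_pdivlMr// mulrC => xn rle.
have := x_D n; have := D_le u; rewrite -/s.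
have : ((r + s) / 2) ^+ 2 <= nrm (y - T (x_ n)) ^+ 2.
  by rewrite ler_pXn2r// ?nnegrE ?nrm_ge0//; lra.
by move: (n.+1%:R^-1) dn => p dn; lra.
Qed.

(** * Invertibility and lower bounds *)

Lemma bounded_below_invertible T : bounded_operator T -> bounded_below T ->
  (forall y, (forall x, '[T x, y] = 0) -> y = 0) -> invertible T.
Proof.
move=> bT bbT Tperp.
have TB : {morph T : x y / x - y} := zmod_morphism_linear bT.1.
have TD u v : T (u + v) = T u + T v by have := bT.1 1 u v; rewrite !scale1r.
have TZ : scalable T := scalable_linear bT.1.
have /bounded_below_nrm[c c0 cT] := bbT.
have injT x y : T x = T y -> x = y.
  move=> Txy; apply/eqP; rewrite -subr_eq0; apply/eqP/nrm_eq0/eqP.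
  have := cT (x - y); rewrite TB Txy subrr nrm0 pmulr_rle0// => le0.
  by rewrite eq_le le0 nrm_ge0.
have /choice[S TS] : forall y, exists x, T x = y.
  move=> y; have [x xmin] := exists_nearest_image y bT bbT.
  exists x; apply/esym/eqP; rewrite -subr_eq0; apply/eqP/Tperp => z.
  rewrite hdot_conj orthogonal_of_nearest ?rmorph0// => a.
  (* By linearity the competitor is y - T (x + a z). *)
  rewrite -addrA -opprD -TZ -TD; exact: xmin.
exists S; split; [split | |]; last 2 first.
- by apply/funext => x /=; apply: injT; rewrite TS.
- by apply/funext => x /=; rewrite TS.
- by move=> a x y; apply: injT; rewrite TD TZ !TS.
exists c^-1 => y; rewrite !nrmE -rmorphM lecR mulrC ler_pdivlMr// mulrC.
by rewrite -{2}(TS y) cT.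
Qed.

(** If [M] bounds the inverse S, then |x| = |S (T x)| is at most M |T x|. *)
Lemma invertible_bounded_below T : invertible T -> bounded_below T.
Proof.
move=> [S [bS ST _]]; have [M M0 SM] := bounded_operator_nrm bS.
apply/bounded_below_nrm; exists M^-1 => [|x]; first by rewrite invr_gt0.
rewrite ler_pdivrMl//; apply: le_trans (SM _).
by have -> : S (T x) = x by exact: (congr1 (@^~ x) ST).
Qed.

(** * Minimum modulus *)

(** Normalizing vectors turns the infimum into a lower bound. A nonzero vector makes the unit sphere
    nonempty; [inf] of the empty set is 0 by default. *)
Lemma min_modulus_gt0 T : linear T -> (exists x : H, x != 0) ->
  0 < min_modulus T <-> bounded_below T.
Proof.
move=> linT [x0 x0N0].
have TZ : scalable T := scalable_linear linT.
have unit_norm x : x != 0 -> `|((nrm x)^-1%:C)%C *: x| = 1.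
  move=> xN0; rewrite nrmE nrmZ ger0_norm ?invr_ge0 ?nrm_ge0//.
  by rewrite mulVf// (contra_neq (@nrm_eq0 _ _ _)).
rewrite bounded_below_nrm; split=> [m0|[c c0 cT]].
  exists (min_modulus T) => // x; have [->|xN0] := eqVneq x 0.
    by rewrite nrm0 mulr0 nrm_ge0.
  have x_gt0 : 0 < nrm x.
    by rewrite lt_def nrm_ge0 (contra_neq (@nrm_eq0 _ _ _)).
  have : min_modulus T <= nrm (T (((nrm x)^-1%:C)%C *: x)).
    apply: ge_inf; first by exists 0 => _ [z _ <-]; exact: nrm_ge0.
    by exists (((nrm x)^-1%:C)%C *: x) => //; exact: unit_norm.
  by rewrite TZ nrmZ gtr0_norm ?invr_gt0// ler_pdivlMl// mulrC.
apply: (lt_le_trans c0); apply: lb_le_inf.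
  by eexists; exists (((nrm x0)^-1%:C)%C *: x0) => //; exact: unit_norm.
by move=> _ [z /= z1 <-]; have := cT z; rewrite /(nrm z) z1 mulr1.
Qed.

(** The zero space is spanned by the empty family. *)
Lemma infinite_dimensional_neq0 :
  infinite_dimensional H -> exists x : H, x != 0.
Proof.
move=> infH; apply: contrapT => no_x; apply: infH.
exists 0, (fun=> 0) => x; exists (fun=> 0); rewrite big_ord0.
by apply/eqP/negPn/negP => xN0; apply: no_x; exists x.
Qed.

(* No appeal to Riesz: here 0 is the only candidate for the adjoint. *)
Lemma adjoint_eq0 T y : (forall x, '[T x, y] = 0) -> adjoint T y = 0.
Proof.
move=> Ty0; rewrite /adjoint; case: xgetP => // z _ /= Tyz.
by apply: hdot_eq0; rewrite -Tyz Ty0.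
Qed.

(** * Consequences of complex symmetry *)

Lemma complex_symmetric_adjoint T C : conjugation C ->
  T = C \o adjoint T \o C -> adjoint T = C \o T \o C.
Proof.
move=> [_ _ CC] TE; apply/funext => x /=.
by rewrite [in RHS]TE /= !CC.
Qed.

(** [C] permutes the unit sphere and preserves norms, so both infima range over the same set. *)
Lemma complex_symmetric_min_modulus T :
  complex_symmetric T -> min_modulus T = min_modulus (adjoint T).
Proof.
move=> [C conjC TE]; rewrite (complex_symmetric_adjoint conjC TE).
have [_ CN CC] := conjC; congr inf; apply/seteqP; split=> _ [x /= x1 <-].
  by exists (C x); rewrite /= ?CN// CC.
by exists (C x); rewrite /= ?CN.
Qed.

(** Orthogonality gives T^* y = C T C y = 0, so T C y = 0, and the lower bound at C y yields c |y|
    <= 0. *)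
Lemma complex_symmetric_orthogonal_image T y : complex_symmetric T ->
  bounded_below T -> (forall x, '[T x, y] = 0) -> y = 0.
Proof.
move=> [C conjC TE] [c c0 cT] /adjoint_eq0.
rewrite (complex_symmetric_adjoint conjC TE) /=.
have [_ CN _] := conjC => /(congr1 Num.norm); rewrite CN normr0 => TCy.
have := cT (C y); rewrite TCy CN pmulr_rle0 ?(ltcR 0)// normr_le0.
by move/eqP.
Qed.

End HilbertLemmas.

Theorem proposition3p4 (R : realType) (H : hilbertType R) (T : H -> H)
    (infH : infinite_dimensional H) (sepH : separable H)
    (bT : bounded_operator T) (csT : complex_symmetric T) :
  [/\ min_modulus T = min_modulus (adjoint T),
      bounded_below T <-> invertible T &
      0 < min_modulus T <-> invertible T].
Proof.
have bb_inv : bounded_below T <-> invertible T.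
  split=> [bbT|]; last exact: invertible_bounded_below.
  apply: bounded_below_invertible => // y.
  exact: complex_symmetric_orthogonal_image.
split=> //; first exact: complex_symmetric_min_modulus.
rewrite min_modulus_gt0//; first exact: bT.1.
exact: infinite_dimensional_neq0.
Qed.
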